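(* Let $p\in\mathbb{R}[x_1,\ldots,x_n]$, let $S\subset\mathbb{R}^n$ and $\bar x\in S$ be such that $S$ coincides with $\{x\in\mathbb{R}^n:p(x)=0\}$ in a neighborhood of $\bar x$, and assume $\nabla p(\bar x)\ne0$. Then for every $u\in T_S(\bar x)$, $$T^2_S(\bar x;u)=\{w\in\mathbb{R}^n:\nabla p(\bar x)w+u^T\nabla^2p(\bar x)u=0\}.$$ Thus $S$ is parabolically regular at $\bar x$ in every tangent direction $u\in T_S(\bar x)$.
   Context: Bouligand tangent cone: $T_S(\bar x)=\{u\in\mathbb{R}^n:\exists t_k\downarrow 0,\ \exists u_k\to u \text{ with } \bar x+t_ku_k\in S\text{ for all }k\}$ ($t_k\downarrow0$ means $t_k>0$, $t_k\to0$). $T^2_S(\bar x;u)=T^{2,\mathrm{out}}_S(\bar x;u)$ is the outer parabolic second-order tangent set: all $w\in\mathbb{R}^n$ such that there exist $t_k\downarrow0$ and $w_k\to w$ with $\bar x+t_ku+\tfrac12t_k^2w_k\in S$ for all $k$. The inner parabolic tangent set $T^{2,\mathrm{in}}_S(\bar x;u)$ consists of all $w$ such that for every sequence $t_k\downarrow0$ there exist $w_k\to w$ with $\bar x+t_ku+\tfrac12t_k^2w_k\in S$ (membership being required for all sufficiently large $k$). $S$ is parabolically regular at $\bar x$ in direction $u$ if $T^{2,\mathrm{in}}_S(\bar x;u)=T^{2,\mathrm{out}}_S(\bar x;u)$. $\nabla p(\bar x)w$ denotes the inner product of the gradient with $w$; $\nabla^2p$ is the Hessian. *)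

(* Defs.v *)
From HB Require Import structures.
From mathcomp Require Import all_boot all_order all_algebra.
From mathcomp Require Import all_classical all_reals all_analysis.
(* Not imported: some notations of mpoly clash with those of the analysis
   library. *)
From mathcomp Require mpoly.

Set Implicit Arguments.
Unset Strict Implicit.
Unset Printing Implicit Defensive.

Import Order.TTheory GRing.Theory Num.Theory.
Import numFieldNormedType.Exports.

Local Open Scope classical_set_scope.
Local Open Scope ring_scope.

Definition poly_eval (R : realType) (n : nat) (p : mpoly.mpoly n R)
    (x : 'cV[R]_n) : R :=
  mpoly.meval (fun i => x i 0) p.

Definition gradient (R : realType) (n : nat) (p : mpoly.mpoly n R)
    (x : 'cV[R]_n) : 'cV[R]_n :=
  \col_i poly_eval (mpoly.mderiv i p) x.

Definition hessian (R : realType) (n : nat) (p : mpoly.mpoly n R)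
    (x : 'cV[R]_n) : 'M[R]_n :=
  \matrix_(i, j) poly_eval (mpoly.mderiv j (mpoly.mderiv i p)) x.

Definition inner (R : realType) (n : nat) (v w : 'cV[R]_n) : R :=
  (v^T *m w) 0 0.

(* The convergence need not be monotone. *)
Definition decreases_to_zero (R : realType) (t : nat -> R) : Prop :=
  (forall k, 0 < t k) /\ t k @[k --> \oo] --> (0 : R).

Definition tangent_cone (R : realType) (n : nat) (S : set 'cV[R]_n)
    (xbar : 'cV[R]_n) : set 'cV[R]_n :=
  [set u | exists (t : nat -> R) (uk : nat -> 'cV[R]_n),
    [/\ decreases_to_zero t,
        uk k @[k --> \oo] --> u
      & forall k, S (xbar + t k *: uk k)]].

Definition outer_tangent2 (R : realType) (n : nat) (S : set 'cV[R]_n)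
    (xbar u : 'cV[R]_n) : set 'cV[R]_n :=
  [set w | exists (t : nat -> R) (wk : nat -> 'cV[R]_n),
    [/\ decreases_to_zero t,
        wk k @[k --> \oo] --> w
      & forall k, S (xbar + t k *: u + (2^-1 * t k ^+ 2) *: wk k)]].

Definition inner_tangent2 (R : realType) (n : nat) (S : set 'cV[R]_n)
    (xbar u : 'cV[R]_n) : set 'cV[R]_n :=
  [set w | forall t : nat -> R, decreases_to_zero t ->
    exists wk : nat -> 'cV[R]_n,
      wk k @[k --> \oo] --> w /\
      \forall k \near \oo,
        S (xbar + t k *: u + (2^-1 * t k ^+ 2) *: wk k)].

Definition parabolically_regular (R : realType) (n : nat) (S : set 'cV[R]_n)
    (xbar u : 'cV[R]_n) : Prop :=
  inner_tangent2 S xbar u = outer_tangent2 S xbar u.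

(* Main.v *)
Require Import Defs.
From HB Require Import structures.
From mathcomp Require Import all_boot all_order all_algebra.
From mathcomp Require Import all_classical all_reals all_analysis.
From mathcomp Require mpoly.
Import (canonicals) mpoly.
From mathcomp Require Import ring lra.

Set Implicit Arguments.
Unset Strict Implicit.
Unset Printing Implicit Defensive.

Import Order.TTheory GRing.Theory Num.Theory.
Import numFieldNormedType.Exports.

Local Open Scope classical_set_scope.
Local Open Scope ring_scope.

(** Write g and H for the gradient and the Hessian of p at x. Everything rests
    on one expansion with a remainder that depends continuously on both the
    step and the direction ([taylor2_continuous]):
      p (x + t v) = p x + t <g, v> + t^2 F (t, v),  F (0, v) = <v, H v> / 2.
    If x + t_k v_k lies in the zero set, with t_k -> 0 and v_k -> u, dividing by
    t_k gives <g, u> = 0 in the limit. A parabolic arc x + t u + t^2/2 w is the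
    point reached from x in the direction v = u + t/2 w with step t, so once
    p x = <g, u> = 0 ([parabolic_factor]):
      p (x + t u + t^2/2 w) = t^2/2 (<g, w> + 2 F (t, u + t/2 w)).
    When t -> 0 and the second-order directions converge to w, the bracket tends
    to <g, w> + <u, H u>. Hence every outer tangent w satisfies
    the second-order equation.

    Conversely, let w satisfy the equation and let t_k -> 0. Correct w along the
    gradient: at w + s g the bracket tends to s <g, g>, so for large k it changes
    sign between s = -1 and s = 1, and the intermediate value theorem gives a
    zero s_k in [-1, 1]. Boundedness of s_k makes the directions
    u + t_k/2 (w + s_k g) tend to u, and then the vanishing of the bracket forces
    s_k <g, g> -> 0. So w_k = w + s_k g -> w, and w is an inner
    tangent ([inner_tangent2_of_equation]). Inner tangents being outer tangents,
    the three sets coincide. *)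

(** * The inner product on column vectors *)

Section Inner.
Variables (R : realType) (n : nat).
Implicit Types (a b v w : 'cV[R]_n) (c : R).

Lemma innerE v w : inner v w = \sum_i v i 0 * w i 0.
Proof. by rewrite /inner mxE; apply: eq_bigr => i _; rewrite mxE. Qed.

Lemma innerDl a b v : inner (a + b) v = inner a v + inner b v.
Proof. by rewrite /inner linearD /= mulmxDl mxE. Qed.

Lemma innerDr v a b : inner v (a + b) = inner v a + inner v b.
Proof. by rewrite /inner mulmxDr mxE. Qed.

Lemma innerZl c a v : inner (c *: a) v = c * inner a v.
Proof. by rewrite /inner linearZ /= -scalemxAl mxE. Qed.

Lemma innerZr c v a : inner v (c *: a) = c * inner v a.
Proof. by rewrite /inner -scalemxAr mxE. Qed.

Lemma inner_self_gt0 v : v <> 0 -> 0 < inner v v.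
Proof.
move=> v0; rewrite lt_def innerE; apply/andP; split; last first.
  by apply: sumr_ge0 => i _; rewrite -expr2 sqr_ge0.
apply/eqP => /eqP; rewrite psumr_eq0; last first.
  by move=> i _; rewrite -expr2 sqr_ge0.
move/allP => h; apply: v0; apply/matrixP => i j; rewrite ord1 mxE.
by have := h i (mem_index_enum i); rewrite /= mulf_eq0 orbb => /eqP.
Qed.

Lemma inner_rank1 a b v : inner v (a *m b^T *m v) = inner a v * inner b v.
Proof.
rewrite /inner -mulmxA mulmxA mxE big_ord1.
by congr (_ * _); rewrite !mxE; apply: eq_bigr => i _; rewrite !mxE mulrC.
Qed.

Lemma inner_continuous a : continuous (inner a).
Proof.
rewrite (_ : inner a = fun v => \sum_i a i 0 * v i 0); last first.
  by apply/funext => v; rewrite innerE.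
have coordM (i : 'I_n) : continuous (fun v : 'cV[R]_n => a i 0 * v i 0).
  move=> v; apply: continuousM; first exact: cst_continuous.
  exact: coord_continuous.
exact: (@continuous_big R _ +%R 0 xpredT (@add_continuous R^o)).
Qed.

End Inner.

(** * Second-order expansion of a polynomial *)

(** Identities stable under the ring operations, such as the Taylor expansion,
    need only be checked on constants and variables. *)
Lemma mpoly_ring_ind (R : realType) (n : nat) (P : mpoly.mpoly n R -> Prop) :
  (forall c, P (mpoly.mpolyC n c)) ->
  (forall i, P (mpoly.mpolyX R (mpoly.mnm1 i))) ->
  (forall p q, P p -> P q -> P (p + q)) ->
  (forall p q, P p -> P q -> P (p * q)) ->
  forall p, P p.
Proof.
move=> PC PX PD PM p; rewrite (mpoly.mpolyE p).
have P0 : P 0 by have := PC 0; rewrite mpoly.mpolyC0.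
have P1 : P 1 by have := PC 1; rewrite mpoly.mpolyC1.
apply: (big_ind P) => [//|q r Pq Pr|m _]; first exact: PD.
rewrite -mpoly.mul_mpolyC; apply: (PM) => //.
rewrite mpoly.mpolyXE_id; apply: (big_ind P) => [//|q r Pq Pr|i _].
  exact: PM.
elim: (mpoly.fun_of_multinom m i) => [|k IH]; first by rewrite expr0.
by rewrite exprS; apply: PM.
Qed.

Section Derivatives.
Variables (R : realType) (n : nat) (x : 'cV[R]_n).
Implicit Types p q : mpoly.mpoly n R.

Lemma gradientD p q : gradient (p + q) x = gradient p x + gradient q x.
Proof.
by apply/matrixP => i j; rewrite !mxE mpoly.mderivD /poly_eval mpoly.mevalD.
Qed.

Lemma hessianD p q : hessian (p + q) x = hessian p x + hessian q x.
Proof.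
by apply/matrixP => i j; rewrite !mxE !mpoly.mderivD /poly_eval mpoly.mevalD.
Qed.

Lemma gradientM p q : gradient (p * q) x =
  poly_eval p x *: gradient q x + poly_eval q x *: gradient p x.
Proof.
apply/matrixP => i j; rewrite !mxE mpoly.mderivM /poly_eval.
by rewrite mpoly.mevalD !mpoly.mevalM; ring.
Qed.

Lemma hessianM p q : hessian (p * q) x =
  poly_eval p x *: hessian q x + poly_eval q x *: hessian p x
  + gradient p x *m (gradient q x)^T + gradient q x *m (gradient p x)^T.
Proof.
apply/matrixP => i j; rewrite !mxE !big_ord1 !mxE mpoly.mderivM mpoly.mderivD.
by rewrite !mpoly.mderivM /poly_eval !mpoly.mevalD !mpoly.mevalM; ring.
Qed.

Lemma gradientC c : gradient (mpoly.mpolyC n c) x = 0.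
Proof.
by apply/matrixP => i j; rewrite !mxE mpoly.mderivC /poly_eval mpoly.meval0.
Qed.

Lemma hessianC c : hessian (mpoly.mpolyC n c) x = 0.
Proof.
apply/matrixP => i j; rewrite !mxE mpoly.mderivC mpoly.mderiv0 /poly_eval.
by rewrite mpoly.meval0.
Qed.

Lemma mderiv_var i k : mpoly.mderiv k (mpoly.mpolyX R (mpoly.mnm1 i)) =
  mpoly.mpolyC n ((i == k)%:R).
Proof.
rewrite mpoly.mderivX mpoly.mnm1E; case: eqP => [->|_].
  rewrite -{1}[mpoly.mnm1 k]mpoly.add0m mpoly.addmK.
  by rewrite mpoly.mpolyX0 scale1r mpoly.mpolyC1.
by rewrite scale0r mpoly.mpolyC0.
Qed.

Lemma gradient_var i :
  gradient (mpoly.mpolyX R (mpoly.mnm1 i)) x = delta_mx i 0.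
Proof.
apply/matrixP => k j; rewrite !mxE mderiv_var /poly_eval mpoly.mevalC.
by rewrite ord1 andbT eq_sym.
Qed.

Lemma hessian_var i : hessian (mpoly.mpolyX R (mpoly.mnm1 i)) x = 0.
Proof.
apply/matrixP => k j; rewrite !mxE mderiv_var mpoly.mderivC /poly_eval.
by rewrite mpoly.meval0.
Qed.

End Derivatives.

(** The remainder is asked to be jointly continuous, rather than just bounded,
    so that limits along steps t_k -> 0 and directions v_k -> v can be read off
    directly; its value at t = 0 carries the Hessian term. In this form the
    property passes to products: the remainder of p * q is
      p x G + q x F + <grad p, v> <grad q, v>
        + t (<grad p, v> G + <grad q, v> F) + t^2 F G,
    and the products of gradients are the rank-one terms of [hessianM]. *)
Lemma taylor2_continuous (R : realType) (n : nat) (p : mpoly.mpoly n R)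
    (x : 'cV[R]_n) :
  exists F : R * 'cV[R]_n -> R,
    [/\ continuous F,
        forall v, F (0, v) = 2^-1 * inner v (hessian p x *m v)
      & forall t v, poly_eval p (x + t *: v) =
          poly_eval p x + t * inner (gradient p x) v + t ^+ 2 * F (t, v)].
Proof.
have fst_cont : continuous (fun z : R * 'cV[R]_n => z.1).
  by move=> z; exact: cvg_fst.
have inner_cont a : continuous (fun z : R * 'cV[R]_n => inner a z.2).
  move=> z; apply: (continuous_comp (f := snd)); first exact: cvg_snd.
  exact: inner_continuous.
have cstc (c : R) : continuous (fun _ : R * 'cV[R]_n => c).
  exact: cst_continuous.
have addc (f h : R * 'cV[R]_n -> R) : continuous f -> continuous h ->
    continuous (fun z => f z + h z).
  by move=> cf ch z; apply: continuousD; [exact: cf|exact: ch].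
have mulc (f h : R * 'cV[R]_n -> R) : continuous f -> continuous h ->
    continuous (fun z => f z * h z).
  by move=> cf ch z; apply: continuousM; [exact: cf|exact: ch].
move: p; apply: mpoly_ring_ind.
- move=> c; exists (fun=> 0); split => [z|v|t v].
  + exact: cvg_cst.
  + by rewrite hessianC mul0mx /inner mulmx0 mxE mulr0.
  + rewrite gradientC /inner trmx0 mul0mx mxE /poly_eval !mpoly.mevalC /=.
    by ring.
- move=> i; exists (fun=> 0); split => [z|v|t v].
  + exact: cvg_cst.
  + by rewrite hessian_var mul0mx /inner mulmx0 mxE mulr0.
  + rewrite gradient_var innerE (bigD1 i) //= big1 ?mxE ?eqxx; last first.
      by move=> k /negbTE ki; rewrite mxE ki mul0r.
    by rewrite /poly_eval !mpoly.mevalXU !mxE /=; ring.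
- move=> p q [F [Fc F0 FE]] [G [Gc G0 GE]]; exists (fun z => F z + G z).
  split => [z|v|t v]; first by apply: cvgD; [exact: Fc|exact: Gc].
  + by rewrite F0 G0 hessianD mulmxDl innerDr; ring.
  + move: (FE t v) (GE t v); rewrite gradientD innerDl /poly_eval !mpoly.mevalD.
    by move=> -> ->; ring.
- move=> p q [F [Fc F0 FE]] [G [Gc G0 GE]].
  exists (fun z => poly_eval p x * G z + poly_eval q x * F z
    + inner (gradient p x) z.2 * inner (gradient q x) z.2
    + z.1 * (inner (gradient p x) z.2 * G z + inner (gradient q x) z.2 * F z)
    + z.1 * z.1 * (F z * G z)).
  split => [|v|t v].
  + have cp := inner_cont (gradient p x).
    have cq := inner_cont (gradient q x).
    by do ![assumption | exact: (cstc) | apply: (addc) | apply: (mulc)].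
  + rewrite F0 G0 hessianM /= !mulmxDl !innerDr -!scalemxAl !innerZr.
    rewrite !inner_rank1 /=.
    by field.
  + have -> : poly_eval (p * q) (x + t *: v) =
        poly_eval p (x + t *: v) * poly_eval q (x + t *: v).
      by rewrite /poly_eval mpoly.mevalM.
    rewrite FE GE gradientM innerDl !innerZl.
    have -> : poly_eval (p * q) x = poly_eval p x * poly_eval q x.
      by rewrite /poly_eval mpoly.mevalM.
    move=> /=; ring.
Qed.

(** At a zero of p and in a direction orthogonal to the gradient, the orders 0
    and 1 of the expansion along a parabolic arc vanish identically. *)
Lemma parabolic_factor (R : realType) (n : nat) (p : mpoly.mpoly n R)
    (x u : 'cV[R]_n) (F : R * 'cV[R]_n -> R) :
  poly_eval p x = 0 -> inner (gradient p x) u = 0 ->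
  (forall t v, poly_eval p (x + t *: v) =
     poly_eval p x + t * inner (gradient p x) v + t ^+ 2 * F (t, v)) ->
  forall t w, poly_eval p (x + t *: u + (2^-1 * t ^+ 2) *: w) =
    2^-1 * t ^+ 2 *
      (inner (gradient p x) w + 2 * F (t, u + (2^-1 * t) *: w)).
Proof.
move=> px gu FE t w.
have -> : x + t *: u + (2^-1 * t ^+ 2) *: w = x + t *: (u + (2^-1 * t) *: w).
  by rewrite scalerDr scalerA addrA; congr (_ + _ *: _); ring.
by rewrite FE px innerDr innerZr gu; field.
Qed.

(** * Parabolic arcs along vanishing steps *)

Section Sequences.
Variables (R : realType) (n : nat).
Implicit Types (t : nat -> R) (u x z : 'cV[R]_n).

Lemma cvg_scale0 t (w : nat -> 'cV[R]_n) z :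
  t k @[k --> \oo] --> (0 : R) -> w k @[k --> \oo] --> z ->
  t k *: w k @[k --> \oo] --> (0 : 'cV[R]_n).
Proof. by move=> t0 ww; rewrite -(scale0r z); exact: cvgZ. Qed.

Lemma cvg_arc_direction u t (w : nat -> 'cV[R]_n) z :
  t k @[k --> \oo] --> (0 : R) -> w k @[k --> \oo] --> z ->
  u + (2^-1 * t k) *: w k @[k --> \oo] --> u.
Proof.
move=> t0 ww; rewrite -[X in _ --> X]addr0; apply: cvgD; first exact: cvg_cst.
apply: (cvg_scale0 _ ww); rewrite -[X in _ --> X](mulr0 2^-1).
by apply: cvgM => //; exact: cvg_cst.
Qed.

Lemma cvg_arc x u t (w : nat -> 'cV[R]_n) z :
  t k @[k --> \oo] --> (0 : R) -> w k @[k --> \oo] --> z ->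
  x + t k *: u + (2^-1 * t k ^+ 2) *: w k @[k --> \oo] --> x.
Proof.
move=> t0 ww.
have -> : (fun k => x + t k *: u + (2^-1 * t k ^+ 2) *: w k) =
          (fun k => x + t k *: (u + (2^-1 * t k) *: w k)).
  apply/funext => k; rewrite scalerDr scalerA addrA.
  by congr (_ + _ *: _); ring.
rewrite -[X in _ --> X]addr0; apply: cvgD; first exact: cvg_cst.
exact: (cvg_scale0 t0 (cvg_arc_direction (u := u) t0 ww)).
Qed.

(** Test the inner condition on the steps 1/(k+1), and drop the finitely many
    indices at which membership may fail. *)
Lemma inner_tangent2_sub_outer (S : set 'cV[R]_n) x u :
  inner_tangent2 S x u `<=` outer_tangent2 S x u.
Proof.
move=> w /(_ (@harmonic R)).
have hz : decreases_to_zero (@harmonic R).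
  by split; [move=> k; exact: harmonic_gt0|exact: cvg_harmonic].
move=> /(_ hz) [wk [wkw [N _ NS]]].
exists (fun k => harmonic (k + N)%N), (fun k => wk (k + N)%N); split.
- split=> [k|]; first exact: harmonic_gt0.
  apply: (cvg_comp (addn^~ N) harmonic (cvg_addnr N)).
  exact: cvg_harmonic.
- exact: (cvg_comp (addn^~ N) wk (cvg_addnr N) wkw).
- by move=> k; apply: NS; rewrite /= leq_addl.
Qed.

End Sequences.

(** * Tangents of first and second order to a regular zero set *)

Section ZeroSet.
Variables (R : realType) (n : nat) (p : mpoly.mpoly n R) (x : 'cV[R]_n).
Variables (S : set 'cV[R]_n) (Sx : S x).
Hypothesis Szeros : \forall y \near nbhs x, S y <-> poly_eval p y = 0.
Variable F : R * 'cV[R]_n -> R.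
Hypothesis Fcont : continuous F.
Hypothesis F0 : forall v, F (0, v) = 2^-1 * inner v (hessian p x *m v).
Hypothesis FE : forall t v, poly_eval p (x + t *: v) =
     poly_eval p x + t * inner (gradient p x) v + t ^+ 2 * F (t, v).

Let g := gradient p x.

Lemma poly_eval_center : poly_eval p x = 0.
Proof. by apply/(nbhs_singleton Szeros). Qed.

Lemma cvg_remainder (t : nat -> R) (v : nat -> 'cV[R]_n) u :
  t k @[k --> \oo] --> (0 : R) -> v k @[k --> \oo] --> u ->
  F (t k, v k) @[k --> \oo] --> F (0, u).
Proof.
move=> t0 vu.
exact: (cvg_comp (fun k => (t k, v k)) F (cvg_pair t0 vu) (@Fcont (0, u))).
Qed.

Lemma tangent_cone_orthogonal u : tangent_cone S x u -> inner g u = 0.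
Proof.
move=> [t [v [[tpos t0] vu Sk]]].
have yx : x + t k *: v k @[k --> \oo] --> x.
  rewrite -[X in _ --> X]addr0; apply: cvgD; first exact: cvg_cst.
  exact: cvg_scale0 vu.
have key : \forall k \near \oo, inner g (v k) + t k * F (t k, v k) = 0.
  near=> k.
  have : poly_eval p (x + t k *: v k) = 0.
    have : S (x + t k *: v k) <-> poly_eval p (x + t k *: v k) = 0.
      by near: k; exact: yx Szeros.
    by case=> + _; apply.
  rewrite FE poly_eval_center add0r expr2 -mulrA -mulrDr => /eqP.
  by rewrite mulf_eq0 gt_eqF //= => /eqP.
have lim : inner g (v k) + t k * F (t k, v k) @[k --> \oo] --> inner g u.
  rewrite -[X in _ --> X]addr0 -(mul0r (F (0, u))); apply: cvgD.
    exact: (cvg_comp v (inner g) vu (@inner_continuous _ _ g u)).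
  by apply: cvgM => //; exact: cvg_remainder.
have lim0 : inner g (v k) + t k * F (t k, v k) @[k --> \oo] --> (0 : R).
  exact: cvg_near_cst key.
exact: (cvg_unique _ lim lim0).
Unshelve. all: by end_near. Qed.

Variable u : 'cV[R]_n.
Hypothesis gu : inner g u = 0.

Lemma outer_tangent2_equation w : outer_tangent2 S x u w ->
  inner g w + inner u (hessian p x *m u) = 0.
Proof.
move=> [t [wk [[tpos t0] ww Sk]]].
set lhs := fun k => inner g (wk k) + 2 * F (t k, u + (2^-1 * t k) *: wk k).
have key : \forall k \near \oo, lhs k = 0.
  near=> k.
  have : poly_eval p (x + t k *: u + (2^-1 * t k ^+ 2) *: wk k) = 0.
    have : S (x + t k *: u + (2^-1 * t k ^+ 2) *: wk k) <->
           poly_eval p (x + t k *: u + (2^-1 * t k ^+ 2) *: wk k) = 0.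
      by near: k; exact: (cvg_arc u t0 ww) Szeros.
    by case=> + _; apply.
  rewrite (parabolic_factor poly_eval_center gu FE) => /eqP.
  rewrite mulf_eq0 gt_eqF //=; first by move/eqP.
  by rewrite mulr_gt0 ?invr_gt0 ?exprn_gt0.
have lim : lhs k @[k --> \oo] --> inner g w + inner u (hessian p x *m u).
  apply: cvgD.
    exact: (cvg_comp wk (inner g) ww (@inner_continuous _ _ g w)).
  have -> : inner u (hessian p x *m u) = 2 * F (0, u) by rewrite F0; field.
  apply: cvgM; first exact: cvg_cst.
  by apply: cvg_remainder => //; exact: cvg_arc_direction ww.
have lim0 : lhs k @[k --> \oo] --> (0 : R).
  exact: cvg_near_cst key.
exact: (cvg_unique _ lim lim0).
Unshelve. all: by end_near. Qed.

Hypothesis g_neq0 : g <> 0.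

(** The correction s_k g of w is found by the intermediate value theorem, which
    only gives s_k in [-1, 1]; the equation it solves then forces s_k -> 0. *)
Lemma inner_tangent2_of_equation w :
  inner g w + inner u (hessian p x *m u) = 0 -> inner_tangent2 S x u w.
Proof.
move=> weq t [tpos t0].
(* f k s is the value of p on the arc of w + s g at time t_k, divided by
   t_k^2 / 2. *)
pose f k s :=
  inner g (w + s *: g) + 2 * F (t k, u + (2^-1 * t k) *: (w + s *: g)).
pose c := inner g g.
have c0 : 0 < c by exact: inner_self_gt0.
have f_lim s : f k s @[k --> \oo] --> s * c.
  have -> : s * c = inner g (w + s *: g) + 2 * F (0, u).
    rewrite innerDr innerZr F0 -/c.
    have := weq; lra.
  apply: cvgD; first exact: cvg_cst.
  apply: cvgM; first exact: cvg_cst.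
  apply: cvg_remainder => //.
  by apply: cvg_arc_direction => //; exact: cvg_cst.
have f_cont k : continuous (f k).
  have lin_cont : continuous (fun s : R => w + s *: g).
    move=> s.
    exact: (cvgD (@cst_continuous _ _ w s) (@scalel_continuous _ _ g s)).
  have dir_cont : continuous (fun s : R => u + (2^-1 * t k) *: (w + s *: g)).
    move=> s; apply: (cvgD (@cst_continuous _ _ u s)).
    exact: (continuous_comp (@lin_cont s) (@scaler_continuous _ _ _ _)).
  move=> s.
  have dot_cvg : inner g (w + r *: g) @[r --> s] --> inner g (w + s *: g).
    exact: (continuous_comp (@lin_cont s) (@inner_continuous _ _ g _)).
  have rem_cvg : F (t k, u + (2^-1 * t k) *: (w + r *: g)) @[r --> s] -->
      F (t k, u + (2^-1 * t k) *: (w + s *: g)).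
    have pair_cvg := cvg_pair (@cst_continuous _ _ (t k) s) (@dir_cont s).
    pose arc r := (t k, u + (2^-1 * t k) *: (w + r *: g)).
    exact: (cvg_comp arc F (pair_cvg _ _ _) (@Fcont (arc s))).
  exact: (cvgD dot_cvg (cvgMl_tmp (a := 2) rem_cvg)).
have root_ex : \forall k \near \oo, exists s, `|s| <= 1 /\ f k s = 0.
  near=> k.
  have fm : f k (-1) < 0.
    by near: k; apply: (cvgr_lt (-1 * c)); [exact: f_lim|lra].
  have fp : 0 < f k 1.
    by near: k; apply: (cvgr_gt (1 * c)); [exact: f_lim|lra].
  have [|||s] := @IVT R (f k) (-1) 1 0.
  - lra.
  - by apply: continuous_subspaceT; exact: f_cont.
  - by rewrite ge_min le_max (ltW fm) (ltW fp) orbT.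
  - by rewrite in_itv /= -ler_norml => s1 fs; exists s.
(* The default 0 keeps s_k in [-1, 1] also when there is no root. *)
pose s k := xget 0 [set s | `|s| <= 1 /\ f k s = 0].
have s_bnd k : `|s k| <= 1.
  by rewrite /s; case: xgetP => [y _ [] //|_]; rewrite normr0 ler01.
have s_root : \forall k \near \oo, f k (s k) = 0.
  near=> k; have root_k : exists s, `|s| <= 1 /\ f k s = 0 by near: k.
  by have [] := xgetPex 0 root_k.
have ts0 : t k * s k @[k --> \oo] --> (0 : R).
  apply: norm_cvg0; apply: (@squeeze_cvgr _ _ _ _ (fun=> 0) t) => //; last first.
    exact: cvg_cst.
  apply: nearW => k; rewrite normr_ge0 normrM gtr0_norm //=.
  by rewrite ler_piMr // ltW.
(* Solve f k (s k) = 0 for s k; the directions in F tend to u by ts0. *)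
have s_lim : s k @[k --> \oo] --> (0 : R).
  have -> : (0 : R) = - (inner g w + 2 * F (0, u)) / c.
    by rewrite F0 mulrA divff ?pnatr_eq0 // mul1r weq oppr0 mul0r.
  apply: cvg_trans (_ : (fun k => - (inner g w
    + 2 * F (t k, u + (2^-1 * t k) *: (w + s k *: g))) / c) @ \oo --> _).
    apply: near_eq_cvg; near=> k.
    have : f k (s k) = 0 by near: k.
    rewrite /f innerDr innerZr -/c => fk.
    apply: (mulIf (lt0r_neq0 c0)); rewrite mulfVK ?lt0r_neq0 //.
    by move: fk; lra.
  apply: cvgM; last exact: cvg_cst.
  apply: cvgN; apply: cvgD; first exact: cvg_cst.
  apply: cvgM; first exact: cvg_cst.
  apply: cvg_remainder => //.
  have -> : (fun k => u + (2^-1 * t k) *: (w + s k *: g)) =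
    (fun k => u + (2^-1 * t k) *: w + (2^-1 * (t k * s k)) *: g).
    by apply/funext => k; rewrite scalerDr scalerA addrA !mulrA.
  rewrite -[X in _ --> X]addr0; apply: cvgD.
    by apply: cvg_arc_direction => //; exact: cvg_cst.
  rewrite -(scale0r g); apply: cvgZr_tmp.
  rewrite -[X in _ --> X](mulr0 2^-1).
  by apply: cvgM => //; exact: cvg_cst.
have w_lim : w + s k *: g @[k --> \oo] --> w.
  rewrite -[X in _ --> X]addr0 -(scale0r g); apply: cvgD; first exact: cvg_cst.
  exact: cvgZr_tmp.
exists (fun k => w + s k *: g); split => //.
near=> k.
have [_] : S (x + t k *: u + (2^-1 * t k ^+ 2) *: (w + s k *: g)) <->
    poly_eval p (x + t k *: u + (2^-1 * t k ^+ 2) *: (w + s k *: g)) = 0.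
  by near: k; exact: (cvg_arc u t0 w_lim) Szeros.
apply; rewrite (parabolic_factor poly_eval_center gu FE).
have : f k (s k) = 0 by near: k.
by rewrite /f => ->; rewrite mulr0.
Unshelve. all: by end_near. Qed.

End ZeroSet.

Theorem theorem3p4 (R : realType) (n : nat) (p : mpoly.mpoly n R)
    (S : set 'cV[R]_n) (xbar : 'cV[R]_n)
    (xbarS : S xbar)
    (S_eq_zeros : \forall x \near nbhs xbar, S x <-> poly_eval p x = 0)
    (grad_neq0 : gradient p xbar <> 0) :
  forall u : 'cV[R]_n, tangent_cone S xbar u ->
    outer_tangent2 S xbar u =
      [set w | inner (gradient p xbar) w + inner u (hessian p xbar *m u) = 0]
    /\ parabolically_regular S xbar u.
Proof.
move=> u Tu; have [F [Fc F0 FE]] := taylor2_continuous p xbar.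
have gu := tangent_cone_orthogonal xbarS S_eq_zeros Fc FE Tu.
have out_eq := outer_tangent2_equation xbarS S_eq_zeros Fc F0 FE gu.
have eq_in := inner_tangent2_of_equation xbarS S_eq_zeros Fc F0 FE gu grad_neq0.
have in_out := @inner_tangent2_sub_outer _ _ S xbar u.
split; apply/seteqP; split => w //=; first exact: out_eq.
- by move/eq_in/in_out.
- exact: in_out.
- by move/out_eq/eq_in.
Qed.
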